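(* Let $(Z,X)$ be a pair of real random variables with a continuous joint distribution such that $X$ is stochastically increasing positive dependent (SIPD) in $Z$. Then for all $n\in\mathbb{N}$, $m\in\{1,\dots,n\}$ and $\alpha\in(0,1]$, the success probability satisfies $$1-(1-\alpha)^m\le p_{\mathrm{success}}(n,m,\alpha)\le 1-(1-\alpha)^n .$$
   Context: Setting. Let $(Z_1,X_1),\dots,(Z_n,X_n)$ be i.i.d. copies of $(Z,X)$. Order the $Z$-values as $Z_{1:n}\le\dots\le Z_{n:n}$ (ties have probability zero), and let $X_{\langle i\rangle}$ be the $X$-value attached to $Z_{i:n}$, i.e. $X_{\langle i\rangle}=X_k$ when $Z_{i:n}=Z_k$. Success probability. For $1\le m\le n$ and $\alpha\in(0,1]$, $$p_{\mathrm{success}}(n,m,\alpha):=\Pr\Bigl(\min_{1\le i\le m}X_{\langle i\rangle}\le x_\alpha^*\Bigr),$$ where $x_\alpha^*$ is such that $\Pr(X\le x_\alpha^* )=\alpha$ (with $x_1^*=+\infty$ allowed). SIPD: $X$ is SIPD in $Z$ if $\Pr(X>x\mid Z=z)\le\Pr(X>x\mid Z=z')$ for all real $x$ and all $z\le z'$ in the support of $Z$ (for a suitable version of the conditional distribution). *)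

(* Defs.v *)
From HB Require Import structures.
From mathcomp Require Import all_boot all_order all_algebra.
From mathcomp Require Import all_classical all_reals all_analysis.

Set Implicit Arguments.
Unset Strict Implicit.
Unset Printing Implicit Defensive.

Import Order.TTheory GRing.Theory Num.Theory.
Import numFieldNormedType.Exports.

Local Open Scope classical_set_scope.
Local Open Scope ring_scope.

Definition pair_fun (S T U : Type) (f : S -> T) (g : S -> U) : S -> T * U :=
  fun w => (f w, g w).

(* No structure on the joint law is assumed beyond continuity of its
   cumulative distribution function on the plane; in particular no density. *)
Definition joint_cdf (R : realType) (d : measure_display)
    (Omega : measurableType d) (P : probability Omega R)
    (Z X : {RV P >-> R}) (p : R * R) : R :=
  fine (P (Z @^-1` `]-oo, p.1] `&` X @^-1` `]-oo, p.2])).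

Definition continuous_joint_distribution (R : realType) (d : measure_display)
    (Omega : measurableType d) (P : probability Omega R)
    (Z X : {RV P >-> R}) : Prop :=
  continuous (joint_cdf Z X : R * R -> R).

Definition law_support (R : realType) (d : measure_display)
    (Omega : measurableType d) (P : probability Omega R)
    (Z : {RV P >-> R}) : set R :=
  [set z | forall U : set R, open U -> U z -> (0 < distribution P Z U)%E].

(* [k z B] is a version of P(X \in B | Z = z). *)
Definition conditional_distribution (R : realType) (d : measure_display)
    (Omega : measurableType d) (P : probability Omega R)
    (Z X : {RV P >-> R}) (k : R.-pker R ~> R) : Prop :=
  forall A B : set R, measurable A -> measurable B ->
    P (Z @^-1` A `&` X @^-1` B) = (\int[distribution P Z]_(z in A) k z B)%E.

Definition SIPD (R : realType) (d : measure_display)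
    (Omega : measurableType d) (P : probability Omega R)
    (Z X : {RV P >-> R}) : Prop :=
  exists2 k : R.-pker R ~> R, conditional_distribution Z X k &
    forall x z z' : R, law_support Z z -> law_support Z z' -> z <= z' ->
      (k z `]x, +oo[%classic <= k z' `]x, +oo[%classic)%E.

Definition mutually_independent (R : realType) (d d' : measure_display)
    (Omega : measurableType d) (T : measurableType d')
    (P : probability Omega R) (n : nat) (W : 'I_n -> Omega -> T) : Prop :=
  forall (J : {set 'I_n}) (B : 'I_n -> set T),
    (forall i, measurable (B i)) ->
    P (\bigcap_(i in [set i | i \in J]) (W i @^-1` B i)) =
      (\prod_(i in J) P (W i @^-1` B i))%E.

(* The sample may live on another probability space than (Z, X). *)
Definition iid_copies (R : realType) (d d' : measure_display)
    (Omega : measurableType d) (P : probability Omega R) (Z X : {RV P >-> R})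
    (Omega' : measurableType d') (Q : probability Omega' R)
    (n : nat) (Zs Xs : 'I_n -> {RV Q >-> R}) : Prop :=
  (forall (i : 'I_n) (A : set (R * R)), measurable A ->
     Q (pair_fun (Zs i) (Xs i) @^-1` A) = P (pair_fun Z X @^-1` A)) /\
  mutually_independent Q (fun i => pair_fun (Zs i) (Xs i)).

(* Positions are numbered from 0: [order_index z i] is the index k such that
   z k is the (i+1)-st smallest value; ties are broken by smallest index.
   The default value of [nth] is never used. *)
Definition order_index (R : realType) (n : nat) (z : 'I_n -> R) (i : 'I_n) :
    'I_n :=
  nth i (sort (fun j k => z j <= z k) (enum 'I_n)) i.

Definition order_stat (R : realType) (n : nat) (z : 'I_n -> R) (i : 'I_n) : R :=
  z (order_index z i).

Definition concomitant (R : realType) (n : nat) (z x : 'I_n -> R) (i : 'I_n) :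
    R :=
  x (order_index z i).

Lemma order_index_inj (R : realType) (n : nat) (z : 'I_n -> R) :
  injective (order_index z).
Proof.
move=> i j; rewrite /order_index.
have sz : size (sort (fun j k => z j <= z k) (enum 'I_n)) = n.
  by rewrite size_sort size_enum_ord.
rewrite (set_nth_default i (s := sort _ _) j) ?sz//.
move/eqP; rewrite nth_uniq ?sz//; first by move/eqP/val_inj.
by rewrite sort_uniq enum_uniq.
Qed.

Lemma order_stat_le (R : realType) (n : nat) (z : 'I_n -> R) (i j : 'I_n) :
  (i <= j)%N -> order_stat z i <= order_stat z j.
Proof.
move=> ij; rewrite /order_stat /order_index.
have sz : size (sort (fun j k => z j <= z k) (enum 'I_n)) = n.
  by rewrite size_sort size_enum_ord.
rewrite (set_nth_default i (s := sort _ _) j) ?sz//.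
apply: (sorted_leq_nth (leT := fun j k => z j <= z k)) => //.
- by move=> a b c; exact: le_trans.
- apply: (@sort_sorted _ (fun j k => z j <= z k)) => a b; exact: le_total.
all: by rewrite inE sz.
Qed.

Lemma concomitantE (R : realType) (n : nat) (z x : 'I_n -> R) (i k : 'I_n) :
  injective z -> order_stat z i = z k -> concomitant z x i = x k.
Proof. by move=> zI /zI; rewrite /concomitant => ->. Qed.

(* The minimum is over the first m positions; the neutral element +oo plays no
   role when 1 <= m <= n. The threshold is extended real, to allow x = +oo. *)
Definition p_success (R : realType) (d : measure_display)
    (Omega : measurableType d) (Q : probability Omega R)
    (n : nat) (Zs Xs : 'I_n -> {RV Q >-> R}) (m : nat) (x : \bar R) : \bar R :=
  Q [set w | (\big[Order.min/+oo]_(i < n | (i < m)%N)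
                (concomitant (fun j => Zs j w) (fun j => Xs j w) i)%:E <= x)%E].

(* Main.v *)
Require Import Defs.
From HB Require Import structures.
From mathcomp Require Import all_boot all_order all_algebra.
From mathcomp Require Import all_classical all_reals all_analysis.
From mathcomp Require Import measurable_realfun.

(** Failure means that the [m] lowest concomitants all lie in
    [B = ]xstar, +oo[]. Split this event according to the permutation that sorts
    the [Z]-values; on each piece it says [X_i \in B] for all [i] in a set [S]
    of [m] indices. Given the [Z]-values and the other [X]-values, [X_i \in B]
    has probability [k Z_i B], which by SIPD increases with [Z_i]: exchanging an
    index of [S] for one outside [S], whose [Z]-value is larger, can only
    increase the probability. Hence [S] may be replaced by the first [m]
    indices, and summing over the pieces bounds the failure probability by that
    of [X_i \in B] for all [i < m], i.e. by [(1 - alpha) ^+ m]. It is at least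
    [(1 - alpha) ^+ n] because failure occurs when all [n] values lie in [B]. *)

Set Implicit Arguments.
Unset Strict Implicit.
Unset Printing Implicit Defensive.

Import Order.TTheory GRing.Theory Num.Theory.
Import numFieldNormedType.Exports.

Local Open Scope classical_set_scope.
Local Open Scope ring_scope.

(** * Exchange inequality for sets of equal size *)

(** Induction on the size of [V :\: S]: replacing some [b] of [V :\: S] by some [a] of [S :\: V]
    brings [V] closer to [S] and does not increase [F]. *)
Lemma set_exchange_le (d : Order.disp_t) (L : porderType d) (I : finType)
    (F : {set I} -> L) (S V : {set I}) :
  (forall (a b : I) (U : {set I}), a \in S -> b \notin S ->
     a \notin U -> b \notin U ->
     (F (a |: U)%SET <= F (b |: U)%SET)%O) ->
  #|S| = #|V| -> (F S <= F V)%O.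
Proof.
move=> FE; move: {2}#|V :\: S|%SET (leqnn #|V :\: S|%SET) => c.
elim: c V => [|c IH] V.
  rewrite leqn0 cards_eq0 finset.setD_eq0 => VS SV.
  by have /eqP -> : V == S by rewrite eqEcard VS SV leqnn.
move=> Vc SV; have [V0|/set0Pn[b]] := eqVneq (V :\: S)%SET finset.set0.
  by apply: IH => //; rewrite V0 cards0.
rewrite inE => /andP[bS bV].
(* Equal cardinalities force [S :\: V] and [V :\: S] to have the same size. *)
have /set0Pn[a] : (S :\: V)%SET != finset.set0.
  rewrite -cards_eq0 cardsD finset.setIC SV -cardsD cards_eq0.
  by apply/set0Pn; exists b; rewrite inE bS.
rewrite inE => /andP[aV aS].
have aVb : a \notin (V :\ b)%SET by rewrite !inE negb_and aV orbT.
have bVb : b \notin (V :\ b)%SET by rewrite !inE eqxx.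
rewrite -(finset.setD1K bV); apply: le_trans (FE a b _ aS bS aVb bVb).
apply: IH; last by rewrite cardsU1 aVb SV (cardsD1 b V) bV.
rewrite -ltnS; apply: leq_trans Vc; apply: proper_card.
apply/properP; split; last first.
  have ba : b != a by apply: contraNneq bS => ->.
  by exists b; rewrite !inE ?bS ?bV // eqxx (negbTE ba) andbF.
apply/fintype.subsetP => x; rewrite !inE => /andP[xS /orP[/eqP xa|/andP[_ ->]]].
  by move: xS; rewrite xa aS.
by rewrite xS.
Qed.

(** * Null sets and the support of a law *)

Lemma negligible_countable_bigcup (d : measure_display) (T : measurableType d)
    (R : realType) (mu : {measure set T -> \bar R}) (I : countType)
    (D : set I) (F : I -> set T) :
  (forall i, D i -> mu.-negligible (F i)) ->
  mu.-negligible (\bigcup_(i in D) F i).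
Proof.
move=> NF; rewrite bigcup_mkcond.
pose G k :=
  if unpickle k is Some i then if i \in D then F i else set0 else set0.
apply: (@negligibleS _ _ _ _ (\bigcup_k G k)) => [z [i _ Fz]|].
  by exists (pickle i) => //; rewrite /G pickleK.
apply: negligible_bigcup => k; rewrite /G.
case: unpickle => [i|]; last exact: negligible_set0.
by case: ifPn => [/set_mem /NF//|_]; exact: negligible_set0.
Qed.

(** A point outside the support has a null open neighbourhood, hence lies in a null ball with
    rational centre and radius; there are countably many such balls. *)
Lemma distribution_law_supportC (R : realType) (d : measure_display)
    (Omega : measurableType d) (P : probability Omega R) (Z : {RV P >-> R}) :
  (distribution P Z).-negligible (~` law_support Z).
Proof.
pose J (q : rat * rat) : set R := ball (ratr q.1 : R) (ratr q.2 : R).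
have mJ q : measurable (J q) by exact: measurable_ball.
pose D := [set q : rat * rat | distribution P Z (J q) = 0%E].
apply: (@negligibleS _ _ _ _ (\bigcup_(q in D) J q)) => [z /= /existsNP[U]|].
  move=> /not_implyP[oU] /not_implyP[Uz /negP].
  rewrite lt0e measure_ge0 andbT negbK => /eqP U0.
  have [c [r /= [zB BU]]] := open_subball_rat oU (mem_set Uz).
  exists (c, r); last exact/set_mem.
  apply/eqP; rewrite -measure_le0 -U0 le_measure ?inE//.
  exact: open_measurable.
by apply: negligible_countable_bigcup => q Dq; exact/negligibleP.
Qed.

(** * Conditional probabilities and independence *)

(** Both sides are finite measures in [A], so agreement on the pi-system [G] extends to the
    generated sigma-algebra by Dynkin's argument. *)
Lemma measure_setI_integral_g_sigma (d : measure_display) (T : measurableType d)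
    (R : realType) (Q : {finite_measure set T -> \bar R}) (G : set (set T))
    (D E : set T) (f : T -> \bar R) :
  G `<=` measurable -> setI_closed G -> G setT ->
  measurable D -> measurable E -> measurable_fun setT f ->
  (forall t, 0 <= f t)%E ->
  (forall A, G A -> Q (A `&` D `&` E) = \int[Q]_(t in A `&` D) f t)%E ->
  forall A, <<s G >> A -> Q (A `&` D `&` E) = (\int[Q]_(t in A `&` D) f t)%E.
Proof.
move=> Gm GI GT mD mE mf f0 QG.
have sGm : <<s G >> `<=` measurable.
  exact: smallest_sub (@sigma_algebra_measurable _ T) Gm.
have mfS (B : set T) : measurable_fun B f by exact: measurable_funTS.
apply: (@dynkin_induction _ (g_sigma_algebraType G) G
  (fun A => Q (A `&` D `&` E) = \int[Q]_(t in A `&` D) f t)%E) => //.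
- exact: QG.
- move=> A /sGm mA QA.
  have dAC : [disjoint A `&` D & ~` A `&` D].
    by apply/disj_setPS => t [[At _] [nAt _]]; exact: nAt.
  have DE : D = (A `&` D) `|` (~` A `&` D) by rewrite -setIUl setUv setTI.
  have mAD : d.-measurable (A `&` D) by exact: measurableI.
  have mACD : d.-measurable (~` A `&` D).
    by apply: measurableI => //; exact: measurableC.
  have := QG _ GT; rewrite !setTI {1 2}DE setIUl measureU//; last 3 first.
  + exact: measurableI.
  + exact: measurableI.
  + by rewrite setIACA (disj_set2P dAC) set0I.
  rewrite ge0_integral_setU// => H.
  have fin : Q (A `&` D `&` E) \is a fin_num.
    by rewrite fin_num_measure//; exact: measurableI.
  (* Complements: the identity for [setT] splits along [A], and the finite part over [A] is
     cancelled. *)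
  have : (Q (A `&` D `&` E) + Q (~` A `&` D `&` E) - Q (A `&` D `&` E) =
     Q (A `&` D `&` E) + \int[Q]_(x in ~` A `&` D) f x - Q (A `&` D `&` E))%E.
    by rewrite H QA.
  by rewrite addeAC subee// add0e addeAC subee// add0e.
- move=> F mF tF QF.
  have mF' k : d.-measurable (F k) by apply: sGm; exact: mF.
  rewrite !setI_bigcupl measure_bigcup//; last 2 first.
  + by move=> k _; do 2 apply: measurableI => //.
  + exact/trivIset_setIr/trivIset_setIr.
  rewrite ge0_integral_bigcup//; last 2 first.
  + by move=> k; apply: measurableI.
  + exact/trivIset_setIr.
  apply: congr_lim; apply/funext => m.
  by apply: eq_big => [i|i _]; [rewrite in_setT|exact: QF].
Qed.

(** By independence, the image under [V] of [Q] restricted to [D] is the image of [Q] scaled by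
    [Q D]. *)
Lemma ge0_integral_setI_indep (d d' : measure_display)
    (T : measurableType d) (T' : measurableType d') (R : realType)
    (Q : {finite_measure set T -> \bar R}) (V : T -> T') (D : set T)
    (A : set T') (f : T' -> \bar R) :
  measurable_fun setT V -> measurable D -> measurable A ->
  measurable_fun setT f -> (forall y, 0 <= f y)%E ->
  (forall B, measurable B -> Q (V @^-1` B `&` D) = Q (V @^-1` B) * Q D)%E ->
  (\int[Q]_(t in V @^-1` A `&` D) f (V t) =
   Q D * \int[pushforward Q V]_(y in A) f y)%E.
Proof.
move=> mV mD mA mf f0 QD.
have mVA : measurable (V @^-1` A) by rewrite -[_ @^-1` _]setTI; exact: mV.
have mfV : measurable_fun setT (f \o V) by exact: measurableT_comp.
have mfS (C : set T) : measurable_fun C (f \o V) by exact: measurable_funTS.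
have c0 : 0 <= fine (Q D) by rewrite fine_ge0.
have QDE : (fine (Q D))%:E = Q D by rewrite fineK// fin_num_measure.
transitivity (\int[mrestr Q mD]_(t in V @^-1` A) (f \o V) t)%E.
  rewrite [RHS](@ge0_negligible_integral _ _ _ _ _ (~` D))//; last 3 first.
  - exact: measurableC.
  - by move=> t _; exact: f0.
  - by rewrite /= /mrestr setICl measure0.
  rewrite setDE setCK; apply: eq_measure_integral => C mC CD.
  by rewrite /= /mrestr setIidl// => t /CD[].
rewrite -(@ge0_integral_pushforward _ _ _ _ _ _ mV (mrestr Q mD))//; last first.
  exact: measurable_funTS.
rewrite -QDE -[fine _]/((NngNum c0)%:num) -ge0_integral_mscale//; last first.
  exact: measurable_funTS.
apply: eq_measure_integral => C mC _ /=.
by rewrite /pushforward /mrestr /mscale/= QDE QD// muleC.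
Qed.

Lemma mutually_independent_split (R : realType) (d d' : measure_display)
    (Omega : measurableType d) (T : measurableType d')
    (P : probability Omega R) (n : nat) (W : 'I_n -> Omega -> T)
    (a : 'I_n) (C : 'I_n -> set T) (A : set T) :
  mutually_independent P W -> (forall i, measurable (C i)) -> measurable A ->
  P (W a @^-1` A `&` \bigcap_(i in [set i | i != a]) (W i @^-1` C i)) =
  (P (W a @^-1` A) * P (\bigcap_(i in [set i | i != a]) (W i @^-1` C i)))%E.
Proof.
move=> WI mC mA.
(* With [A] placed at index [a], the product formula over all indices differs from the one over the
   others by the factor at [a]. *)
pose C' i := if i == a then A else C i.
have mC' i : measurable (C' i) by rewrite /C'; case: ifP.
have -> : [set i | i != a] = [set i | i \in ~: [set a]%SET].
  by apply/seteqP; split=> i /=; rewrite !inE.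
have := WI [set: 'I_n]%SET C' mC'; have := WI (~: [set a]%SET) C mC.
move=> -> H; transitivity
    (P (\bigcap_(i in [set i | i \in [set: 'I_n]%SET]) (W i @^-1` C' i))).
  congr (P _); apply/seteqP; split => [w [Aw Cw] i _|w Cw].
    rewrite /= /C'; case: eqP => [->//|/eqP ia].
    by apply: Cw; rewrite /= !inE.
  split; first by have /= := Cw a; rewrite /C' eqxx; apply; rewrite inE.
  move=> i /=; rewrite !inE => ia.
  by have /= := Cw i; rewrite /C' (negbTE ia); apply; rewrite inE.
rewrite H (bigD1 a) ?inE//= /C' eqxx; congr (_ * _)%E.
apply: eq_big => [i|i /andP[_ /negbTE ->]//].
by rewrite !inE.
Qed.

(** * Conditional law of one [X]-value given all the [Z]-values *)

Section concomitants.
Context (R : realType) (d d' : measure_display).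
Context (Omega : measurableType d) (P : probability Omega R).
Context (Z X : {RV P >-> R}).
Context (Omega' : measurableType d') (Q : probability Omega' R) (n : nat).
Context (Zs Xs : 'I_n -> {RV Q >-> R}).
Hypothesis iid : iid_copies Z X Zs Xs.
Context (k : R.-pker R ~> R).
Hypothesis kZX : conditional_distribution Z X k.
Context (B : set R).
Hypothesis mB : measurable B.

Definition all_in (S : {set 'I_n}) : set Omega' :=
  \bigcap_(i in [set i | i \in S]) (Xs i @^-1` B).

(** A pi-system generating the sigma-algebra of the whole family [Zs]. *)
Definition rectangles : set (set Omega') :=
  [set H | exists2 A : 'I_n -> set R,
    forall i, measurable (A i) & H = \bigcap_i (Zs i @^-1` A i)].

Lemma measurable_all_in (S : {set 'I_n}) : measurable (all_in S).
Proof.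
apply: fin_bigcap_measurable => [|i _]; first exact: finite_finset.
by rewrite -[_ @^-1` _]setTI; exact: measurable_funP.
Qed.

Lemma rectangles_measurable : rectangles `<=` measurable.
Proof.
move=> _ [A mA ->]; apply: fin_bigcap_measurable => [|i _].
  exact: finite_finset.
by rewrite -[_ @^-1` _]setTI; exact: measurable_funP.
Qed.

Lemma rectangles_setI : setI_closed rectangles.
Proof.
move=> _ _ [A mA ->] [A' mA' ->]; exists (fun i => A i `&` A' i).
  by move=> i; exact: measurableI.
by rewrite -bigcapI.
Qed.

Lemma rectangles_setT : rectangles setT.
Proof. by exists (fun=> setT) => //; rewrite bigcapT. Qed.

Lemma measurable_kernel_comp (i : 'I_n) :
  measurable_fun setT (fun w => k (Zs i w) B).
Proof.
apply: (@measurableT_comp _ _ _ _ _ _ (fun z => k z B)) => //.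
exact: measurable_kernel.
Qed.

(** On a rectangle the condition on the pair [a] separates from those on the other pairs, gathered
    in [K]. By independence both sides equal [Q K] times the probability that [Z] is in [A a] and
    [X] in [B], which the kernel expresses as an integral. *)
Lemma prob_rectangle_integral (a : 'I_n) (S : {set 'I_n}) (H : set Omega') :
  a \notin S -> rectangles H ->
  Q (H `&` all_in S `&` Xs a @^-1` B) =
  (\int[Q]_(w in H `&` all_in S) k (Zs a w) B)%E.
Proof.
move=> aS [A mA ->]; have [law indep] := iid.
pose W i := pair_fun (Zs i) (Xs i).
have mW i : measurable_fun setT (W i) by exact: measurable_fun_pair.
pose C i := A i `*` (if i \in S then B else setT).
have mC i : measurable (C i) by apply: measurableX => //; case: ifP.
pose K := \bigcap_(i in [set i | i != a]) (W i @^-1` C i).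
have mK : measurable K.
  apply: fin_bigcap_measurable => [|i _]; first exact: finite_finset.
  by rewrite -[_ @^-1` _]setTI; exact: mW.
(* As [a \notin S], index [a] contributes only its constraint on [Zs a]. *)
have HS : \bigcap_i (Zs i @^-1` A i) `&` all_in S = Zs a @^-1` A a `&` K.
  apply/seteqP; split=> [w [AZ BX]|w [AZ KW]].
    split; first exact: AZ.
    by move=> i _; split=> /=; [exact: AZ|case: ifP => // iS; exact: BX].
  have WA i : i != a -> (A i (Zs i w) /\ (i \in S -> B (Xs i w))).
    by move=> /KW[/= AW BW]; split=> // iS; move: BW; rewrite iS.
  split=> i; first by have [->//|/WA[]] := eqVneq i a.
  by have [->/=|/WA[_]//] := eqVneq i a; rewrite (negbTE aS).
have ZW D : Zs a @^-1` D = W a @^-1` (D `*` setT).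
  by apply/seteqP; split=> // w [].
have law' D : measurable D -> Q (Zs a @^-1` D) = distribution P Z D.
  move=> mD; rewrite ZW law; last exact: measurableX.
  by congr (P _); apply/seteqP; split=> // w [].
rewrite HS (@ge0_integral_setI_indep _ _ _ _ _ _ _ _ _ (fun z => k z B))//;
    last 2 first.
- exact: measurable_kernel.
- move=> D mD; rewrite ZW; apply: mutually_independent_split => //.
  exact: measurableX.
rewrite setIAC (_ : _ `&` (Xs a @^-1` B) = W a @^-1` (A a `*` B))//.
rewrite mutually_independent_split//; last exact: measurableX.
rewrite law; last exact: measurableX.
rewrite muleC; congr (_ * _)%E.
rewrite [LHS](kZX (mA a) mB); apply: eq_measure_integral => D mD _.
exact: esym (law' _ mD).
Qed.

(** Order events are not rectangles in general, so the identity is needed on the whole generated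
    sigma-algebra. *)
Lemma prob_g_sigma_integral (a : 'I_n) (S : {set 'I_n}) (H : set Omega') :
  a \notin S -> <<s rectangles >> H ->
  Q (H `&` all_in S `&` Xs a @^-1` B) =
  (\int[Q]_(w in H `&` all_in S) k (Zs a w) B)%E.
Proof.
move=> aS; apply: measure_setI_integral_g_sigma => //.
- exact: rectangles_measurable.
- exact: rectangles_setI.
- exact: rectangles_setT.
- exact: measurable_all_in.
- by rewrite -[_ @^-1` _]setTI; exact: measurable_funP.
- exact: measurable_kernel_comp.
- by move=> A; exact: prob_rectangle_integral.
Qed.

(** * Events given by the sorting of the [Z]-values *)

(** All functions [f] are allowed, but the event is empty unless [f] is a permutation. *)
Definition order_event (f : {ffun 'I_n -> 'I_n}) : set Omega' :=
  [set w | forall i, order_index (fun j => Zs j w) i = f i].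

(* The sort only depends on the finite matrix of the comparisons
   [Zs j w <= Zs k w], each of which is an event of the sigma-algebra. *)
Lemma g_sigma_order_event (f : {ffun 'I_n -> 'I_n}) :
  <<s rectangles >> (order_event f).
Proof.
pose GT := g_sigma_algebraType rectangles.
have mZ i : measurable_fun [set: GT] (Zs i : GT -> R).
  move=> _ A mA; apply: sub_sigma_algebra.
  exists (fun j => if j == i then A else setT) => [j|]; first by case: ifP.
  rewrite setTI; apply/seteqP; split=> [w ZA j _|w /(_ i I)].
    by case: eqP => [->|].
  by rewrite eqxx.
pose cmp (w : GT) : {ffun 'I_n * 'I_n -> bool} :=
  [ffun p => Zs p.1 w <= Zs p.2 w].
have mcmp r : measurable (cmp @^-1` [set r]).
  have -> : cmp @^-1` [set r] =
      \bigcap_p ((fun w => Zs p.1 w <= Zs p.2 w) @^-1` [set r p]).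
    apply/seteqP; split=> [w <- p _|w cmpw]; first by rewrite /= ffunE.
    by apply/ffunP => p; rewrite ffunE; exact: cmpw.
  apply: fin_bigcap_measurable => // p _.
  rewrite -[_ @^-1` _]setTI.
  exact: (measurable_fun_ler (mZ p.1) (mZ p.2)).
have -> : order_event f = \bigcup_(r in [set r : {ffun 'I_n * 'I_n -> bool} |
    forall i, nth i (sort (fun j l => r (j, l)) (enum 'I_n)) i = f i])
    (cmp @^-1` [set r]).
  have sortE w : sort (fun j l => Zs j w <= Zs l w) (enum 'I_n) =
      sort (fun j l => cmp w (j, l)) (enum 'I_n).
    by congr sort; apply/funext => j; apply/funext => l; rewrite ffunE.
  apply/seteqP; split=> [w fw|w [r /= rf wr] i].
    by exists (cmp w) => // i; rewrite -sortE; exact: fw.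
  by rewrite /order_index sortE wr.
exact: (@fin_bigcup_measurable _ GT).
Qed.

Lemma measurable_order_event (f : {ffun 'I_n -> 'I_n}) :
  measurable (order_event f).
Proof.
apply: smallest_sub (g_sigma_order_event f); last exact: rectangles_measurable.
exact: sigma_algebra_measurable.
Qed.

Lemma order_event_le (f : {ffun 'I_n -> 'I_n}) (m : nat) (w : Omega')
    (a b : 'I_n) :
  order_event f w -> a \in f @: [set i : 'I_n | (i < m)%N]%SET ->
  b \notin f @: [set i : 'I_n | (i < m)%N]%SET -> Zs a w <= Zs b w.
Proof.
move=> fw /imsetP[i]; rewrite inE => im ->.
have f_inj : injective f by move=> u v; rewrite -!fw; exact: order_index_inj.
(* [g b] is the position of [b] in the sorted sample; it is at least [m], while [a] sits at a
   position below [m]. *)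
have [g fg gf] := injF_bij f_inj; rewrite -(gf b) => bm.
have {}bm : (m <= g b)%N.
  by rewrite leqNgt; apply: contra bm => bm; apply: imset_f; rewrite inE.
rewrite -!fw.
exact: (@order_stat_le _ _ (fun j => Zs j w) i (g b) (ltnW (leq_trans im bm))).
Qed.

Lemma all_inU1 (a : 'I_n) (S : {set 'I_n}) :
  all_in (a |: S)%SET = all_in S `&` Xs a @^-1` B.
Proof.
apply/seteqP; split=> [w SB|w [SB aB] i /=].
  by split=> [i iS|]; apply: SB; rewrite /= !inE ?eqxx// iS orbT.
by rewrite !inE => /orP[/eqP->//|iS]; exact: SB.
Qed.

Definition low_concomitants_in (m : nat) : set Omega' :=
  [set w | forall i : 'I_n, (i < m)%N ->
     B (concomitant (fun j => Zs j w) (fun j => Xs j w) i)].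

Lemma low_concomitants_inE (m : nat) :
  low_concomitants_in m =
  \bigcup_f (order_event f `&` all_in (f @: [set i : 'I_n | (i < m)%N]%SET)).
Proof.
apply/seteqP; split=> [w Bw|w [f _ [fw SB]] i im].
  exists [ffun i => order_index (fun j => Zs j w) i] => //; split.
    by move=> i; rewrite ffunE.
  move=> _ /imsetP[i + ->]; rewrite inE ffunE; exact: Bw.
rewrite /concomitant fw; apply: SB; apply: imset_f.
by rewrite inE.
Qed.

Lemma measurable_low_concomitants_in (m : nat) :
  measurable (low_concomitants_in m).
Proof.
rewrite low_concomitants_inE; apply: fin_bigcup_measurable => [|f _].
  exact: finite_finset.
by apply: measurableI; [exact: measurable_order_event|exact: measurable_all_in].
Qed.

Lemma all_in_low_concomitants (m : nat) :
  all_in [set: 'I_n]%SET `<=` low_concomitants_in m.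
Proof. by move=> w Bw i _; apply: Bw; rewrite /= inE. Qed.

Lemma prob_all_in (S : {set 'I_n}) :
  Q (all_in S) = ((fine (P (X @^-1` B))) ^+ #|S|)%:E.
Proof.
have [law indep] := iid.
have XW i : Xs i @^-1` B = pair_fun (Zs i) (Xs i) @^-1` (setT `*` B).
  by apply/seteqP; split=> // w [].
rewrite /all_in (eq_bigcapr (fun i _ => XW i)) indep => [|_]; last
  exact: measurableX.
rewrite -prodr_const -prodEFin; apply: eq_bigr => i _.
rewrite law; last exact: measurableX.
rewrite fineK ?fin_num_measure//; last first.
  by rewrite -[_ @^-1` _]setTI; exact: measurable_funP.
by congr (P _); apply/seteqP; split=> // w [].
Qed.

(** * Comparison of failure probabilities under SIPD *)

Hypothesis k_le : forall z z', law_support Z z -> law_support Z z' ->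
  z <= z' -> (k z B <= k z' B)%E.

(** SIPD compares the kernel only at points of the support; this makes the comparison valid almost
    surely along the sample. *)
Lemma negligible_law_supportC (i : 'I_n) :
  Q.-negligible (~` (Zs i @^-1` law_support Z)).
Proof.
have [N [mN N0 ZN]] := distribution_law_supportC Z.
exists (Zs i @^-1` N); split.
- by rewrite -[_ @^-1` _]setTI; exact: measurable_funP.
- rewrite -N0 /=; have [law _] := iid.
  transitivity (Q (pair_fun (Zs i) (Xs i) @^-1` (N `*` setT))).
    by congr (Q _); apply/seteqP; split=> // w [].
  rewrite law; last exact: measurableX.
  by congr (P _); apply/seteqP; split=> // w [].
- by move=> w /= nw; exact: ZN.
Qed.

(** Both sides are integrals over the same event [H] with [all_in S], of the kernel at [Zs a] and at
    [Zs b]; on [H] these integrands are ordered almost everywhere. *)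
Lemma prob_all_in_swap (H : set Omega') (a b : 'I_n) (S : {set 'I_n}) :
  <<s rectangles >> H -> (forall w, H w -> Zs a w <= Zs b w) ->
  a \notin S -> b \notin S ->
  (Q (H `&` all_in (a |: S)%SET) <= Q (H `&` all_in (b |: S)%SET))%E.
Proof.
move=> GH Hab aS bS; rewrite !all_inU1 !setIA !prob_g_sigma_integral//.
have mH : measurable H.
  apply: smallest_sub GH; last exact: rectangles_measurable.
  exact: sigma_algebra_measurable.
have mk (i : 'I_n) D : measurable_fun D (fun w => k (Zs i w) B).
  exact/measurable_funTS/measurable_kernel_comp.
apply: ae_ge0_le_integral => //.
  by apply: measurableI => //; exact: measurable_all_in.
apply: negligibleS (negligibleU (negligible_law_supportC a)
  (negligible_law_supportC b)) => w /= nle.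
apply: contrapT => /not_orP[/contrapT wa /contrapT wb].
by apply: nle => -[Hw _]; apply: k_le => //; exact: Hab.
Qed.

Lemma prob_order_event_all_in (f : {ffun 'I_n -> 'I_n}) (m : nat) :
  (Q (order_event f `&` all_in (f @: [set i : 'I_n | (i < m)%N]%SET)) <=
   Q (order_event f `&` all_in [set i : 'I_n | (i < m)%N]%SET))%E.
Proof.
set S := [set i : 'I_n | (i < m)%N]%SET.
(* A sample point in the event shows [f] injective, so that its image of the first [m] positions has
   the right size for the exchange. *)
have [[w0 fw0]|f0] := pselect (exists w, order_event f w); last first.
  suff -> : order_event f = set0 by rewrite !set0I.
  by rewrite -subset0 => w fw; apply: f0; exists w.
have f_inj : injective f by move=> u v; rewrite -!fw0; exact: order_index_inj.
have := card_imset [in S] f_inj.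
apply: (set_exchange_le (F := fun D => Q (order_event f `&` all_in D))).
move=> a b U aS bS aU bU.
apply: prob_all_in_swap => //; first exact: g_sigma_order_event.
by move=> w fw; exact: order_event_le fw aS bS.
Qed.

Lemma prob_low_concomitants_le (m : nat) :
  (Q (low_concomitants_in m) <= Q (all_in [set i : 'I_n | (i < m)%N]%SET))%E.
Proof.
rewrite low_concomitants_inE; set S := [set i : 'I_n | (i < m)%N]%SET.
have mf f D : measurable (order_event f `&` all_in D).
  apply: measurableI; first exact: measurable_order_event.
  exact: measurable_all_in.
have tf (D : {ffun 'I_n -> 'I_n} -> {set 'I_n}) :
    trivIset setT (fun f => order_event f `&` all_in (D f)).
  move=> f g _ _ [w [[fw _] [gw _]]].
  by apply/ffunP => i; rewrite -fw -gw.
(* Splitting the bound along the same disjoint order events allows a termwise comparison. *)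
have -> : all_in S = \bigcup_f (order_event f `&` all_in S).
  apply/seteqP; split=> [w Sw|w [f _ []]//].
  exists [ffun i => order_index (fun j => Zs j w) i] => //; split=> //.
  by move=> i; rewrite ffunE.
have finT : finite_set [set: {ffun 'I_n -> 'I_n}] by exact: finite_finset.
rewrite !measure_fin_bigcup//.
by apply: lee_fsum => // f _; exact: prob_order_event_all_in.
Qed.

End concomitants.

(** * From the failure event to the success probability *)

Lemma card_ord_lt (n m : nat) :
  (m <= n)%N -> #|[set i : 'I_n | (i < m)%N]%SET| = m.
Proof.
move=> mn; rewrite (_ : [set i | _]%SET = widen_ord mn @: [set: 'I_m]%SET).
  rewrite card_imset ?cardsT ?card_ord// => i j /(congr1 val) /= ij.
  exact: val_inj.
apply/setP => i; rewrite inE; apply/idP/imsetP => [im|[j _ ->]]; last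
  exact: (ltn_ord j).
by exists (Ordinal im) => //; exact: val_inj.
Qed.

Lemma success_setE (R : realType) (n m : nat) (x : 'I_n -> R) (xstar : \bar R) :
  (1 <= m)%N -> (m <= n)%N ->
  (\big[Order.min/+oo]_(i < n | (i < m)%N) (x i)%:E <= xstar)%E <->
  ~ (forall i : 'I_n, (i < m)%N -> xstar < (x i)%:E)%E.
Proof.
move=> m0 mn; rewrite leNgt; split=> [/negP + H|H].
  apply; apply/bigmin_gtP; split=> //.
  (* Position 0 lies below [m], so [xstar] is below a real number and hence below the neutral
     element [+oo]. *)
  exact: lt_trans (H (Ordinal (leq_trans m0 mn)) m0) (ltry _).
by apply/negP => /bigmin_gtP[_ H']; exact: H.
Qed.

(** For infinite thresholds the set is empty or full, and the kernel is constantly 0 or 1 there. *)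
Lemma SIPD_kernel_gt_le (R : realType) (k : R.-pker R ~> R) (S : set R)
    (xstar : \bar R) :
  (forall x z z', S z -> S z' -> z <= z' ->
     (k z `]x, +oo[%classic <= k z' `]x, +oo[%classic)%E) ->
  forall z z', S z -> S z' -> z <= z' ->
    (k z [set y | (xstar < y%:E)%E] <= k z' [set y | (xstar < y%:E)%E])%E.
Proof.
move=> kle z z' Sz Sz' zz'; case: xstar => [x||].
- rewrite (_ : [set y | _] = `]x, +oo[%classic); first exact: kle.
  by apply/seteqP; split=> y /=; rewrite in_itv/= andbT lte_fin.
- rewrite (_ : [set y | _] = set0) ?measure0//.
  by apply/seteqP; split=> y.
- rewrite (_ : [set y | _] = setT) ?prob_kernel//.
  by apply/seteqP; split=> y //= _; rewrite ltNyr.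
Qed.

Theorem proposition3p3 (R : realType)
    (d : measure_display) (Omega : measurableType d) (P : probability Omega R)
    (Z X : {RV P >-> R})
    (hcont : continuous_joint_distribution Z X)
    (hSIPD : SIPD Z X)
    (n m : nat) (hm1 : (1 <= m)%N) (hmn : (m <= n)%N)
    (d' : measure_display) (Omega' : measurableType d')
    (Q : probability Omega' R) (Zs Xs : 'I_n -> {RV Q >-> R})
    (hiid : iid_copies Z X Zs Xs)
    (alpha : R) (halpha0 : 0 < alpha) (halpha1 : alpha <= 1)
    (xstar : \bar R)
    (hxstar : P [set w | ((X w)%:E <= xstar)%E] = alpha%:E) :
  ((1 - (1 - alpha) ^+ m)%:E <= p_success Zs Xs m xstar)%E /\
  (p_success Zs Xs m xstar <= (1 - (1 - alpha) ^+ n)%:E)%E.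
Proof.
have [k kZX kle] := hSIPD.
pose B := [set y : R | (xstar < y%:E)%E].
have mB : measurable B.
  by rewrite -[B]setTI; exact: emeasurable_fun_o_infty.
have mXB : measurable (X @^-1` B).
  by rewrite -[_ @^-1` _]setTI; exact: measurable_funP.
have PB : fine (P (X @^-1` B)) = 1 - alpha.
  have XB : X @^-1` B = ~` [set w | ((X w)%:E <= xstar)%E].
    by apply/seteqP; split=> w; rewrite /B /= ltNge => /negP.
  have mXle : measurable [set w | ((X w)%:E <= xstar)%E].
    by rewrite -[X in measurable X]setCK -XB; exact: measurableC.
  by rewrite XB probability_setC// hxstar.
have success : p_success Zs Xs m xstar =
    (1 - Q (low_concomitants_in Zs Xs B m))%E.
  rewrite -probability_setC; last exact: measurable_low_concomitants_in.
  by congr (Q _); apply/seteqP; split=> w /success_setE; exact.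
have Bprob := prob_all_in hiid mB.
(* Passing to the complement reverses the bounds: the lower one needs the exchange argument, the
   upper one only an inclusion of events. *)
rewrite success !EFinB; split; apply: leeB => //.
- have := prob_low_concomitants_le hiid kZX mB (SIPD_kernel_gt_le xstar kle) m.
  by rewrite Bprob PB card_ord_lt.
- have <- : Q (all_in Xs B [set: 'I_n]%SET) = ((1 - alpha) ^+ n)%:E.
    by rewrite Bprob PB cardsT card_ord.
  rewrite le_measure ?inE//.
  + exact: measurable_all_in.
  + exact: measurable_low_concomitants_in.
  + exact: all_in_low_concomitants.
Qed.
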